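(* There exists a constant $C\in\mathbb{R}$ such that for all $q=(q^{1,c},q^{1,p},\ldots,q^{r,c},q^{r,p})\in(\mathcal{M}_1(\mathcal{Z}))^{2r}$, $$\lim_{N\to\infty}\bar F^N(q)=F(q),$$ where $$\begin{aligned}F(q)=&\sum_{j=1}^r\frac{\beta}{2}\bigg\{(\alpha_jp_j^c)^2\sum_{z\in\mathcal{Z}}\Big(\sum_{z'\in\mathcal{Z}}W(z,z')q_{z'}^{j,c}\Big)q_z^{j,c}+2\alpha_j^2p_j^pp_j^c\sum_{z\in\mathcal{Z}}\Big(\sum_{z'\in\mathcal{Z}}W(z,z')q_{z'}^{j,p}\Big)q_z^{j,c}\\&\qquad+\alpha_jp_j^p\sum_{z\in\mathcal{Z}}\Big(\sum_{k=1}^r\alpha_kp_k^p\sum_{z'\in\mathcal{Z}}W(z,z')q_{z'}^{k,p}\Big)q_z^{j,p}\bigg\}\\&+\sum_{j=1}^r\Big(\alpha_jp_j^c\sum_{z\in\mathcal{Z}}q_z^{j,c}\log q_z^{j,c}+\alpha_jp_j^p\sum_{z\in\mathcal{Z}}q_z^{j,p}\log q_z^{j,p}\Big)+C.\end{aligned}$$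
   Context: **Graph.** $\mathcal{Z}=\{1,\ldots,K\}$ is a finite set and $\mathcal{M}_1(\mathcal{Z})$ is the set of probability measures on $\mathcal{Z}$. For each $N$, a set of $N$ nodes is partitioned into $r$ blocks $C_1,\ldots,C_r$ with $|C_j|=N_j$, and each block is partitioned as $C_j=C_j^c\cup C_j^p$ (central and peripheral nodes) with $|C_j^c|=N_j^c$, $|C_j^p|=N_j^p$. Put $C^p=\bigcup_{j=1}^rC_j^p$. Standing assumption: there are $\alpha_j,p_j^c,p_j^p\in(0,1)$ with $p_j^c+p_j^p=1$ and $\sum_j\alpha_j=1$ such that, as $N\to\infty$, $N_j/N\to\alpha_j$, $N_j^c/N_j\to p_j^c$, $N_j^p/N_j\to p_j^p$ for $1\le j\le r$. **Gibbs measure.** $W:\mathcal{Z}\times\mathcal{Z}\to\mathbb{R}$ is symmetric, $\beta>0$, and for $\boldsymbol{x}\in\mathcal{Z}^N$ (one coordinate per node) $$U_N(\boldsymbol{x})=\frac{\beta}{2N}\sum_{j=1}^r\Big[\sum_{i\in C_j^c}\sum_{k\in C_j}W(x_i,x_k)+\sum_{i\in C_j^p}\sum_{k\in C_j^c\cup C^p}W(x_i,x_k)\Big],\qquad \pi^N(\boldsymbol{x})=\frac1{Z_N}e^{-U_N(\boldsymbol{x})},$$ with $Z_N=\sum_{\boldsymbol{x}\in\mathcal{Z}^N}e^{-U_N(\boldsymbol{x})}$. **Normalized relative entropy.** For probability measures $p,p'$ on $\mathcal{Z}^N$, $R(p\|p')=\sum_{\boldsymbol{x}\in\mathcal{Z}^N}p(\boldsymbol{x})\log\frac{p(\boldsymbol{x})}{p'(\boldsymbol{x})}$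 (with $0\log0=0$). For $q\in(\mathcal{M}_1(\mathcal{Z}))^{2r}$, $$\bar F^N(q)=\frac1NR\Big(\otimes^{N_1^c}q^{1,c}\otimes^{N_1^p}q^{1,p}\cdots\otimes^{N_r^c}q^{r,c}\otimes^{N_r^p}q^{r,p}\,\Big\|\,\pi^N\Big),$$ where the first argument is the product probability measure on $\mathcal{Z}^N$ under which the coordinates are independent and each coordinate indexed by a node of $C_j^\iota$ has law $q^{j,\iota}$ ($1\le j\le r$, $\iota\in\{c,p\}$). Also $0\log0=0$ in $F$. *)

(* Defs.v *)
From mathcomp Require Import all_boot all_order all_algebra.
From mathcomp Require Import all_classical all_reals all_analysis.

Set Implicit Arguments.
Unset Strict Implicit.
Unset Printing Implicit Defensive.

Import Order.TTheory GRing.Theory Num.Theory.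
Import numFieldNormedType.Exports.

Local Open Scope ring_scope.

Section Graph.
Variables (r N : nat).

(* An indexed partition of the nodes into r possibly empty blocks is the same
   thing as a function sending each node to the index of its block. *)
Record block_graph := BlockGraph {
  block_of : {ffun 'I_N -> 'I_r};
  central_nodes : {set 'I_N}
}.

Variable G : block_graph.

Definition block (j : 'I_r) : {set 'I_N} := [set i | block_of G i == j].
Definition central (j : 'I_r) : {set 'I_N} := block j :&: central_nodes G.
Definition peripheral (j : 'I_r) : {set 'I_N} := block j :\: central_nodes G.
Definition all_peripheral : {set 'I_N} := (\bigcup_(j < r) peripheral j)%SET.

End Graph.

Section Gibbs.
Variables (R : realType) (K r : nat).
Variables (W : 'I_K -> 'I_K -> R) (beta : R).

Definition energy (N : nat) (G : block_graph r N) (x : {ffun 'I_N -> 'I_K}) : R :=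
  beta / (2 * N%:R) *
  \sum_(j < r)
    (\sum_(i in central G j) \sum_(k in block G j) W (x i) (x k) +
     \sum_(i in peripheral G j)
       \sum_(k in central G j :|: all_peripheral G) W (x i) (x k)).

Definition partition_function (N : nat) (G : block_graph r N) : R :=
  \sum_(x : {ffun 'I_N -> 'I_K}) expR (- energy G x).

Definition gibbs (N : nat) (G : block_graph r N) (x : {ffun 'I_N -> 'I_K}) : R :=
  expR (- energy G x) / partition_function G.

End Gibbs.

Definition is_prob (R : realType) (T : finType) (p : T -> R) : Prop :=
  (forall x, 0 <= p x) /\ \sum_x p x = 1.

(* Real-valued, hence meaningful only for p' positive wherever p is, which
   always holds when p' is a Gibbs measure. The convention 0 log 0 = 0 holds
   since the factor p x vanishes. *)
Definition rel_entropy (R : realType) (T : finType) (p p' : T -> R) : R :=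
  \sum_x p x * ln (p x / p' x).

Section FreeEnergy.
Variables (R : realType) (K r : nat).

Definition product_measure (N : nat) (G : block_graph r N)
    (qc qp : 'I_r -> 'I_K -> R) (x : {ffun 'I_N -> 'I_K}) : R :=
  \prod_(j < r) ((\prod_(i in central G j) qc j (x i)) *
                 (\prod_(i in peripheral G j) qp j (x i))).

Definition Fbar (W : 'I_K -> 'I_K -> R) (beta : R)
    (N : nat) (G : block_graph r N) (qc qp : 'I_r -> 'I_K -> R) : R :=
  N%:R^-1 * rel_entropy (product_measure G qc qp) (gibbs W beta G).

Definition F (W : 'I_K -> 'I_K -> R) (beta : R) (alpha pc pp : 'I_r -> R)
    (C : R) (qc qp : 'I_r -> 'I_K -> R) : R :=
  \sum_(j < r) beta / 2 *
    ((alpha j * pc j) ^+ 2 *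
       (\sum_(z < K) (\sum_(z' < K) W z z' * qc j z') * qc j z) +
     2 * alpha j ^+ 2 * pp j * pc j *
       (\sum_(z < K) (\sum_(z' < K) W z z' * qp j z') * qc j z) +
     alpha j * pp j *
       (\sum_(z < K)
          (\sum_(k < r) alpha k * pp k * \sum_(z' < K) W z z' * qp k z') *
          qp j z)) +
  \sum_(j < r)
    (alpha j * pc j * (\sum_(z < K) qc j z * ln (qc j z)) +
     alpha j * pp j * (\sum_(z < K) qp j z * ln (qp j z))) +
  C.

End FreeEnergy.

(* Main.v *)
(* Expanding the logarithm, Fbar(q) equals the rate function of the group
   densities at q, plus (1/N) ln Z_N, up to an O(1/N) error from the diagonal
   interactions. So everything rests on the limit of (1/N) ln Z_N, which is
   minus the infimum I of the limiting rate function: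
   - nonnegativity of the relative entropy of a product measure with respect
     to the Gibbs measure gives (1/N) ln Z_N >= - I - o(1);
   - for a configuration x with empirical family e, the weight exp(- U(x)) is
     exactly exp(- N rate(e)) times the probability of x under the product
     measure of e. Each of the polynomially many types contributes a total
     probability at most 1, hence (1/N) ln Z_N <= - I + o(1).
   Uniformity in q of the convergence of the rate functions, needed to compare
   the infima, comes from their explicit dependence on the densities. *)
Require Import Defs.
From mathcomp Require Import all_boot all_order all_algebra.
From mathcomp Require Import all_classical all_reals all_analysis.
From mathcomp Require Import ring lra.
Set Implicit Arguments.
Unset Strict Implicit.
Unset Printing Implicit Defensive.

Import Order.TTheory GRing.Theory Num.Theory.
Import numFieldNormedType.Exports.
Local Open Scope classical_set_scope.
Local Open Scope ring_scope.

(** * Elementary bounds on probabilities, logarithms and relative entropy *)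

Lemma prob_le1 (R : realType) (T : finType) (p : T -> R) x :
  is_prob p -> 0 <= p x <= 1.
Proof.
move=> [p0 p1]; rewrite p0 -p1 (bigD1 x) //= lerDl.
by apply: sumr_ge0.
Qed.

Lemma prob_sum_norm (R : realType) (T : finType) (p f : T -> R) :
  is_prob p -> `|\sum_x p x * f x| <= \sum_x `|f x|.
Proof.
move=> pp; apply: le_trans (ler_norm_sum _ _ _) _.
apply: ler_sum => x _; have /andP[p0 p1] := prob_le1 x pp.
by rewrite normrM ger0_norm // ler_piMl.
Qed.

(** The bound [ln y < y] at [y = x^-1], multiplied by [x], gives [- x * ln x <= 1]. *)
Lemma norm_xlnx_le1 (R : realType) (x : R) : 0 <= x <= 1 -> `|x * ln x| <= 1.
Proof.
move=> /andP[x0 x1]; have [->|xN0] := eqVneq x 0; first by rewrite mul0r normr0.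
have {xN0}x0 : 0 < x by rewrite lt_neqAle eq_sym xN0.
have lx0 := ln_le0 x1.
rewrite ler0_norm; last by rewrite mulr_ge0_le0 // ltW.
rewrite -mulrN -lnV ?posrE //.
have xV0 : 0 < x^-1 by rewrite invr_gt0.
have /ltW := ln_sublinear xV0.
by rewrite -(ler_pM2l x0) divff // gt_eqF.
Qed.

Lemma ln_prod (R : realType) (I : finType) (f : I -> R) :
  (forall i, 0 < f i) -> ln (\prod_i f i) = \sum_i ln (f i).
Proof.
move=> f0; apply: (@expR_inj R); rewrite lnK ?posrE ?prodr_gt0 // expR_sum.
by apply: eq_bigr => i _; rewrite lnK ?posrE.
Qed.

(** Gibbs' inequality holds after termwise comparison: [ln u <= u - 1] at [u = p' x / p x] bounds
    each term below by [p x - p' x], and these differences sum to 0. *)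
Lemma rel_entropy_ge0 (R : realType) (T : finType) (p p' : T -> R) :
  is_prob p -> is_prob p' -> (forall x, 0 < p' x) -> 0 <= rel_entropy p p'.
Proof.
move=> [p0 p1] [_ p'1] p'0.
have -> : 0 = \sum_x (p x - p' x) :> R by rewrite sumrB p1 p'1 subrr.
apply: ler_sum => x _.
have [px0|pN0] := eqVneq (p x) 0.
  by rewrite px0 mul0r sub0r oppr_le0 ltW.
have px0 : 0 < p x by rewrite lt_neqAle eq_sym pN0 p0.
rewrite -[p x / p' x]invrK lnV ?posrE ?invr_gt0 ?divr_gt0 // invf_div.
have h : ln (p' x / p x) <= p' x / p x - 1.
  have := @le_ln1Dx R (p' x / p x - 1); rewrite (addrC 1) subrK; apply.
  by rewrite ltrBrDr addNr divr_gt0.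
rewrite mulrN -opprB lerN2; apply: le_trans (ler_wpM2l (p0 x) h) _.
by rewrite mulrBr mulr1 mulrCA divff // mulr1.
Qed.

(** Writing [n + 1 = y ^ 2], one has [ln (n + 1) = 2 * ln y <= 2 * y], and [n + 1 <= 2 * n] turns
    this into the bound [4 / y] on the quotient. *)
Lemma ln_succ_div_cvg0 (R : realType) :
  (ln n.+1%:R / n%:R : R) @[n --> \oo] --> 0.
Proof.
have h0 : (4 * Num.sqrt (harmonic n) : R) @[n --> \oo] --> 0.
  rewrite -[0](mulr0 4); apply: cvgM; first exact: cvg_cst.
  rewrite -[X in _ --> X]sqrtr0.
  by apply: (@continuous_cvg _ _ _ _ _ _ (@Num.sqrt R));
    [exact: sqrt_continuous | exact: cvg_harmonic].
apply: (squeeze_cvgr _ (cvg_cst 0) h0).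
near=> n.
have n0 : (0 < n)%N by near: n; exact: nbhs_infty_gt.
have nR : 0 < n%:R :> R by rewrite ltr0n.
apply/andP; split.
  by rewrite divr_ge0 ?ler0n // ln_ge0 // ler1n.
set y := Num.sqrt (n.+1%:R : R).
have y0 : 0 < y by rewrite sqrtr_gt0 ltr0n.
have y2 : y ^+ 2 = n.+1%:R by rewrite sqr_sqrtr // ler0n.
rewrite /harmonic /= sqrtrV ?ler0n // -/y -y2 lnXn // ler_pdivrMr //.
have -> : 4 * y^-1 * n%:R = 4 * n%:R / y by rewrite mulrAC.
rewrite ler_pdivlMr //.
have := ln_sublinear y0 => hl.
apply: (@le_trans _ _ (y *+ 2 * y)).
  by rewrite ler_pM2r // lerMn2r /= ltW.
have -> : y *+ 2 * y = y ^+ 2 *+ 2 by rewrite mulrnAl.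
rewrite y2 -natr1 -mulr_natr.
have : 1 <= n%:R :> R by rewrite ler1n.
lra.
Unshelve. all: by end_near. Qed.

(** * Rate function of a mean-field model with finitely many groups *)

Section FiniteModel.
Variables (R : realType) (J S : finType) (w : J -> J -> S -> S -> R).

Definition family := J -> S -> R.
Definition prob_family (q : family) := forall j, is_prob (q j).

Definition mean_w (q : family) j k : R :=
  \sum_s \sum_t q j s * (q k t * w j k s t).

Definition rate (rho : J -> R) (q : family) : R :=
  \sum_j \sum_k rho j * rho k * mean_w q j k +
  \sum_j rho j * \sum_s q j s * ln (q j s).

Definition w_norm j k : R := \sum_s \sum_t `|w j k s t|.

(** A bound on the change of [rate] that is free of [q], whence uniform convergence. The factor
    [#|S|] comes from [|x * ln x| <= 1] at each of the [#|S|] states. *)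
Definition rate_dist (rho rho' : J -> R) : R :=
  \sum_j \sum_k `|rho j * rho k - rho' j * rho' k| * w_norm j k +
  \sum_j `|rho j - rho' j| * #|S|%:R.

Lemma mean_w_norm q j k : prob_family q -> `|mean_w q j k| <= w_norm j k.
Proof.
move=> hq; rewrite /mean_w.
under eq_bigr => s _ do rewrite -mulr_sumr.
apply: le_trans (prob_sum_norm _ (hq j)) _.
by apply: ler_sum => s _; apply: prob_sum_norm.
Qed.

Lemma rate_distP rho rho' q : prob_family q ->
  `|rate rho q - rate rho' q| <= rate_dist rho rho'.
Proof.
move=> hq; rewrite /rate opprD addrACA -!sumrB.
apply: le_trans (ler_normD _ _) _; apply: lerD.
  apply: le_trans (ler_norm_sum _ _ _) _; apply: ler_sum => j _.
  rewrite -sumrB; apply: le_trans (ler_norm_sum _ _ _) _.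
  apply: ler_sum => k _; rewrite -mulrBl normrM ler_wpM2l //.
  exact: mean_w_norm.
apply: le_trans (ler_norm_sum _ _ _) _; apply: ler_sum => j _.
rewrite -mulrBl normrM ler_wpM2l //.
apply: le_trans (ler_norm_sum _ _ _) _.
rewrite -sum1_card natr_sum; apply: ler_sum => s _.
by apply: norm_xlnx_le1; apply: prob_le1.
Qed.

(** * Product measures and the Gibbs measure on a finite set of grouped nodes *)

Variables (V : finType) (g : V -> J).

Definition count_group j : nat := #|[pred i | g i == j]|.
Definition density j : R := (count_group j)%:R / #|V|%:R.

Definition pair_energy (x : {ffun V -> S}) : R :=
  #|V|%:R^-1 * \sum_i \sum_k w (g i) (g k) (x i) (x k).
Definition pair_Z : R := \sum_(x : {ffun V -> S}) expR (- pair_energy x).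
Definition pair_gibbs (x : {ffun V -> S}) : R :=
  expR (- pair_energy x) / pair_Z.
Definition indep (q : family) (x : {ffun V -> S}) : R := \prod_i q (g i) (x i).

Lemma sum_group (f : J -> R) : \sum_i f (g i) = \sum_j (count_group j)%:R * f j.
Proof.
rewrite (partition_big g xpredT) //=; apply: eq_bigr => j _.
under eq_bigr => i /eqP -> do [].
by rewrite sumr_const mulr_natl.
Qed.

Lemma sum_indep (F : V -> S -> R) :
  \sum_(x : {ffun V -> S}) \prod_i F i (x i) = \prod_i \sum_s F i s.
Proof. by rewrite bigA_distr_bigA. Qed.

Lemma indep_prob q : prob_family q -> is_prob (indep q).
Proof.
move=> hq; split=> [x|]; first by apply: prodr_ge0 => i _; case: (hq (g i)).
by rewrite (sum_indep (fun i => q (g i))) big1 // => i _; case: (hq (g i)).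
Qed.

Lemma indep_expect1 q i0 (f : S -> R) : prob_family q ->
  \sum_x indep q x * f (x i0) = \sum_s q (g i0) s * f s.
Proof.
move=> hq.
(* Absorbing [f] into the factor at [i0] makes the sum factorise; every other factor is a total mass
   1. *)
transitivity (\sum_(x : {ffun V -> S})
  \prod_i (q (g i) (x i) * if i == i0 then f (x i) else 1)).
  apply: eq_bigr => x _; rewrite big_split /=; congr (_ * _).
  by rewrite -big_mkcond big_pred1_eq.
rewrite (sum_indep (fun i s => q (g i) s * if i == i0 then f s else 1)).
rewrite (bigD1 i0) //= eqxx [X in _ * X]big1 ?mulr1 // => i /negPf ->.
by under eq_bigr do rewrite mulr1; case: (hq (g i)).
Qed.

Lemma indep_expect2 q i0 k0 (f : S -> S -> R) : prob_family q -> i0 != k0 ->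
  \sum_x indep q x * f (x i0) (x k0) =
  \sum_s \sum_t q (g i0) s * (q (g k0) t * f s t).
Proof.
move=> hq ik.
(* A function of two coordinates need not be a product, so [f] is expanded over indicators of the
   pair of values; each indicator does split over the coordinates. *)
transitivity (\sum_s \sum_t f s t * \sum_(x : {ffun V -> S})
  \prod_i (q (g i) (x i) * (if i == i0 then (x i == s)%:R else 1)
            * (if i == k0 then (x i == t)%:R else 1))).
  under [RHS]eq_bigr => s _ do under eq_bigr => t _ do rewrite mulr_sumr.
  under [RHS]eq_bigr => s _ do rewrite exchange_big.
  rewrite [RHS]exchange_big /=; apply: eq_bigr => x _.
  under [RHS]eq_bigr => s _ do under eq_bigr => t _ do
    rewrite 2!big_split /= -!big_mkcond !big_pred1_eq.
  rewrite (bigD1 (x i0)) //= [X in _ + X]big1 ?addr0; last first.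
    move=> s /negPf h; rewrite big1 // => t _.
    by rewrite eq_sym h mulr0 mul0r mulr0.
  rewrite (bigD1 (x k0)) //= [X in _ + X]big1 ?addr0; last first.
    by move=> t /negPf h; rewrite (eq_sym (x k0)) h !mulr0.
  by rewrite !eqxx !mulr1 mulrC.
apply: eq_bigr => s _; apply: eq_bigr => t _.
rewrite (sum_indep (fun i u => q (g i) u * (if i == i0 then (u == s)%:R else 1)
            * (if i == k0 then (u == t)%:R else 1))).
rewrite (bigD1 i0) //= (bigD1 k0) 1?eq_sym //=.
rewrite [X in _ * (_ * (_ * X))]big1; last first.
  move=> i /andP[/negPf -> /negPf ->].
  by under eq_bigr do rewrite !mulr1; case: (hq (g i)).
rewrite !eqxx (eq_sym k0) (negPf ik).
have dirac (p : S -> R) u : \sum_v p v * (v == u)%:R = p u.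
  rewrite (bigD1 u) //= eqxx mulr1 big1 ?addr0 // => v /negPf ->.
  by rewrite mulr0.
under eq_bigr do rewrite mulr1.
under [X in _ * (_ * (X * _))]eq_bigr do rewrite mulr1.
rewrite !dirac; ring.
Qed.

Lemma pair_Z_gt0 : (0 < #|S|)%N -> 0 < pair_Z.
Proof.
move=> /card_gt0P[s _]; rewrite /pair_Z (bigD1 [ffun=> s]) //=.
by apply: ltr_wpDr; rewrite ?expR_gt0 // sumr_ge0 // => x _; rewrite expR_ge0.
Qed.

Lemma pair_gibbs_gt0 x : (0 < #|S|)%N -> 0 < pair_gibbs x.
Proof. by move=> S0; rewrite divr_gt0 ?expR_gt0 ?pair_Z_gt0. Qed.

Lemma pair_gibbs_prob : (0 < #|S|)%N -> is_prob pair_gibbs.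
Proof.
move=> S0; split=> [x|]; first by rewrite ltW // pair_gibbs_gt0.
by rewrite -mulr_suml divff // gt_eqF // pair_Z_gt0.
Qed.

Lemma prob_family_card q : (0 < #|J|)%N -> prob_family q -> (0 < #|S|)%N.
Proof.
move=> /card_gt0P[j _] /(_ j)[_ q1]; apply: contra_eqT q1.
rewrite -eqn0Ngt => /eqP/card0_eq S0.
by rewrite big_pred0 ?(eq_sym 0) ?oner_eq0.
Qed.

Lemma rel_entropy_indep q : (0 < #|S|)%N -> prob_family q ->
  rel_entropy (indep q) pair_gibbs =
  \sum_i \sum_s q (g i) s * ln (q (g i) s) +
  \sum_x indep q x * pair_energy x + ln pair_Z.
Proof.
move=> S0 hq; have [P0 P1] := indep_prob hq.
rewrite -[ln pair_Z]mul1r -P1 mulr_suml.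
under [X in X + _ + _]eq_bigr => i _ do
  rewrite -(@indep_expect1 q i (fun s => ln (q (g i) s)) hq).
rewrite exchange_big -!big_split /=; apply: eq_bigr => x _.
(* Configurations of probability 0 contribute nothing to either side; at the others all factors are
   positive, so the logarithm of the product splits. *)
have [->|PN0] := eqVneq (indep q x) 0.
  by rewrite !mul0r !addr0 big1 // => i _; rewrite mul0r.
have Px0 : 0 < indep q x by rewrite lt_neqAle eq_sym PN0 P0.
rewrite -mulr_sumr -!mulrDr; congr (_ * _).
rewrite ln_div ?posrE ?pair_gibbs_gt0 // ln_div ?posrE ?expR_gt0 ?pair_Z_gt0 //.
rewrite expRK opprB opprK; suff -> : ln (indep q x) = \sum_i ln (q (g i) (x i)).
  by rewrite -addrA; congr (_ + _); rewrite addrC.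
apply: ln_prod => i; rewrite lt_neqAle eq_sym.
case: (hq (g i)) => -> _; rewrite andbT.
by move: PN0; apply: contraNneq => qi0; rewrite /indep (bigD1 i) //= qi0 mul0r.
Qed.

Definition w_total : R := \sum_j \sum_k w_norm j k.

Lemma w_norm_le_total j k : w_norm j k <= w_total.
Proof.
have w0 j' k' : 0 <= w_norm j' k' by do 2!apply: sumr_ge0 => ? _.
rewrite /w_total (bigD1 j) //= (bigD1 k) //= -addrA lerDl addr_ge0 //.
  exact: sumr_ge0.
by do 2!apply: sumr_ge0 => ? _.
Qed.

Lemma w_le_total j k s t : `|w j k s t| <= w_total.
Proof.
apply: le_trans _ (w_norm_le_total j k).
rewrite /w_norm (bigD1 s) //= (bigD1 t) //= -addrA lerDl addr_ge0 //.
  exact: sumr_ge0.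
by do 2!apply: sumr_ge0 => ? _.
Qed.

Lemma sum_density (f : J -> R) : (0 < #|V|)%N ->
  \sum_j density j * f j = #|V|%:R^-1 * \sum_i f (g i).
Proof.
move=> V0; rewrite sum_group mulr_sumr; apply: eq_bigr => j _.
by rewrite /density mulrAC mulrC.
Qed.

(** By independence, pairs of distinct nodes have exactly the mean interaction. Only the [#|V|]
    diagonal pairs deviate, each by at most [2 * w_total], under a prefactor [#|V| ^ -2]. *)
Lemma indep_energy q : (0 < #|V|)%N -> prob_family q ->
  `|#|V|%:R^-1 * (\sum_x indep q x * pair_energy x) -
    \sum_j \sum_k density j * density k * mean_w q j k|
  <= 2 * w_total / #|V|%:R.
Proof.
move=> V0 hq; set n : R := #|V|%:R.
have n0 : 0 < n by rewrite ltr0n.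
pose E i k := \sum_x indep q x * w (g i) (g k) (x i) (x k).
have -> : \sum_x indep q x * pair_energy x = n^-1 * \sum_i \sum_k E i k.
  under [X in _ * X]eq_bigr => i _ do rewrite exchange_big.
  rewrite [X in _ * X]exchange_big mulr_sumr; apply: eq_bigr => x _.
  rewrite mulrCA; congr (_ * _); rewrite mulr_sumr; apply: eq_bigr => i _.
  by rewrite mulr_sumr.
have -> : \sum_j \sum_k density j * density k * mean_w q j k =
    n^-1 * (n^-1 * \sum_i \sum_k mean_w q (g i) (g k)).
  under eq_bigr => j _.
    under eq_bigr => k _ do rewrite -mulrA.
    rewrite -mulr_sumr sum_density //; over.
  rewrite sum_density //; congr (_ * _); rewrite mulr_sumr.
  by apply: eq_bigr.
rewrite -!mulrBr -sumrB.
have -> : \sum_i (\sum_k E i k - \sum_k mean_w q (g i) (g k)) =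
    \sum_i (E i i - mean_w q (g i) (g i)).
  apply: eq_bigr => i _; rewrite -sumrB (bigD1 i) //= big1 ?addr0 // => k ki.
  rewrite /E (@indep_expect2 q i k (w (g i) (g k)) hq) ?subrr //.
  by rewrite eq_sym.
have nV0 : 0 < n^-1 by rewrite invr_gt0.
rewrite !normrM !(gtr0_norm nV0) [leRHS]mulrC ler_pM2l // ler_pdivrMl //.
apply: le_trans (ler_norm_sum _ _ _) _.
rewrite /n -sum1_card natr_sum mulr_suml; apply: ler_sum => i _.
rewrite mul1r; apply: le_trans (ler_normB _ _) _; rewrite mulr2n mulrDl mul1r.
apply: lerD; last by apply: le_trans (mean_w_norm _ _ hq) (w_norm_le_total _ _).
have [P0 P1] := indep_prob hq.
apply: le_trans (ler_norm_sum _ _ _) _.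
rewrite -[leRHS]mul1r -P1 mulr_suml; apply: ler_sum => x _.
by rewrite normrM ger0_norm // ler_wpM2l // w_le_total.
Qed.

Lemma rel_entropy_rate q : (0 < #|V|)%N -> (0 < #|S|)%N -> prob_family q ->
  `|#|V|%:R^-1 * rel_entropy (indep q) pair_gibbs -
    (rate density q + #|V|%:R^-1 * ln pair_Z)| <= 2 * w_total / #|V|%:R.
Proof.
move=> V0 S0 hq; apply: le_trans _ (indep_energy V0 hq).
rewrite rel_entropy_indep // /rate !mulrDr.
rewrite (@sum_density (fun j => \sum_s q j s * ln (q j s))) //.
rewrite le_eqVlt; apply/orP; left; apply/eqP; congr `|_|; ring.
Qed.

(** * Upper bound on the partition function by the method of types *)

Section Types.
Hypothesis count_gt0 : forall j, (0 < count_group j)%N.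

Definition type_count (x : {ffun V -> S}) j s : nat :=
  #|[pred i | (g i == j) && (x i == s)]|.
Definition empirical (x : {ffun V -> S}) : family :=
  fun j s => (type_count x j s)%:R / (count_group j)%:R.
(** Encoding the counts in a finite type lets the types be enumerated. No count exceeds [#|V|], so
    [inord] loses no information. *)
Definition type_of (x : {ffun V -> S}) : {ffun J * S -> 'I_(#|V|.+1)} :=
  [ffun js => inord (type_count x js.1 js.2)].

Lemma empirical_type x y : type_of x = type_of y -> empirical x = empirical y.
Proof.
move=> xy; apply/funext => j; apply/funext => s; rewrite /empirical.
congr (_%:R / _).
have : val (type_of x (j, s)) = val (type_of y (j, s)) by rewrite xy.
by rewrite !ffunE /= !inordK // ltnS max_card.
Qed.

Lemma sum_empirical (x : {ffun V -> S}) (f : J -> S -> R) :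
  \sum_i f (g i) (x i) =
  \sum_j (count_group j)%:R * \sum_s empirical x j s * f j s.
Proof.
rewrite (partition_big g xpredT) //=; apply: eq_bigr => j _.
rewrite (partition_big x xpredT) //= mulr_sumr; apply: eq_bigr => s _.
rewrite /empirical mulrA mulrCA divff ?mulr1; last first.
  by rewrite pnatr_eq0 -lt0n.
under eq_bigr => i /andP[/eqP -> /eqP ->] do [].
by rewrite sumr_const mulr_natl.
Qed.

Lemma empirical_prob x : prob_family (empirical x).
Proof.
move=> j; split=> [s|]; first by rewrite divr_ge0.
have c0 : (count_group j)%:R != 0 :> R by rewrite pnatr_eq0 -lt0n.
rewrite /empirical -mulr_suml; apply: (canLR (mulfK c0)); rewrite mul1r.
rewrite -natr_sum; congr _%:R; rewrite /count_group -sum1_card.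
rewrite (partition_big x xpredT) //=; apply: eq_bigr => s _.
by rewrite sum1_card; apply: eq_card => i; rewrite !inE.
Qed.

Lemma empirical_gt0 (x : {ffun V -> S}) i : 0 < empirical x (g i) (x i).
Proof.
rewrite divr_gt0 ?ltr0n //.
by apply/card_gt0P; exists i; rewrite !inE !eqxx.
Qed.

Lemma indep_empirical_gt0 x : 0 < indep (empirical x) x.
Proof. by apply: prodr_gt0 => i _; exact: empirical_gt0. Qed.

(** The energy, diagonal included, is exactly [#|V|] times the quadratic part of the rate at the
    empirical family. The likelihood of [x] under its own empirical family supplies the entropy
    part, which cancels. *)
Lemma gibbs_weight_empirical x : (0 < #|V|)%N ->
  expR (- pair_energy x) =
  expR (- (#|V|%:R * rate density (empirical x))) * indep (empirical x) x.
Proof.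
move=> V0; have n0 : #|V|%:R != 0 :> R by rewrite pnatr_eq0 -lt0n.
rewrite -[indep _ _]lnK ?posrE ?indep_empirical_gt0 // -expRD; congr expR.
rewrite /indep ln_prod; last exact: empirical_gt0.
rewrite (@sum_empirical x (fun j s => ln (empirical x j s))).
rewrite /pair_energy; under [X in _ * X]eq_bigr => i _ do
  rewrite (@sum_empirical x (fun k t => w (g i) k (x i) t)).
rewrite (@sum_empirical x (fun j s => \sum_k (count_group k)%:R *
   \sum_t empirical x k t * w j k s t)).
have count_density j : (count_group j)%:R = #|V|%:R * density j :> R.
  by rewrite /density mulrCA divff ?mulr1.
rewrite /rate mulrDr opprD -addrA [X in _ = _ + X](_ : _ = 0) ?addr0;
  last first.
  rewrite mulr_sumr -sumrN -big_split big1 //= => j _.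
  by rewrite count_density mulrA addNr.
congr (- _); rewrite !mulr_sumr; apply: eq_bigr => j _.
have -> : \sum_s empirical x j s * (\sum_k (count_group k)%:R *
      \sum_t empirical x k t * w j k s t) =
    #|V|%:R * \sum_k density k * mean_w (empirical x) j k.
  under eq_bigr => s _ do rewrite mulr_sumr.
  rewrite exchange_big mulr_sumr; apply: eq_bigr => k _.
  rewrite count_density mulrA mulr_sumr; apply: eq_bigr => s _.
  by rewrite -mulr_sumr mulrCA.
have -> : \sum_k density j * density k * mean_w (empirical x) j k =
    density j * \sum_k density k * mean_w (empirical x) j k.
  by rewrite mulr_sumr; apply: eq_bigr => k _; rewrite mulrA.
rewrite count_density; by field.
Qed.

(** On one type class the empirical family is constant, so the sum there is the probability of an
    event, at most 1; the right-hand side bounds the number of classes. *)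
Lemma indep_empirical_sum_le :
  \sum_x indep (empirical x) x <= (#|V|.+1%:R ^+ #|{: J * S}|).
Proof.
rewrite (partition_big type_of xpredT) //=.
have -> : #|V|.+1%:R ^+ #|{: J * S}| =
    \sum_(t : {ffun J * S -> 'I_(#|V|.+1)}) 1 :> R.
  by rewrite sumr_const card_ffun card_ord natrX.
apply: ler_sum => t _.
have [x0 /eqP x0t|no] := pickP (fun x => type_of x == t); last first.
  by rewrite big_pred0.
have [P0 P1] := indep_prob (empirical_prob x0).
rewrite -P1 [leRHS](bigID (fun x => type_of x == t)) /=.
apply: ler_wpDr; first exact: sumr_ge0.
apply: ler_sum => x /eqP xt; rewrite (@empirical_type x x0) //.
by rewrite xt x0t.
Qed.

Lemma ln_pair_Z_le c : (0 < #|V|)%N -> (0 < #|S|)%N ->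
  (forall q, prob_family q -> c <= rate density q) ->
  #|V|%:R^-1 * ln pair_Z <=
  - c + #|{: J * S}|%:R * (ln #|V|.+1%:R / #|V|%:R).
Proof.
move=> V0 S0 hc; have n0 : 0 < #|V|%:R :> R by rewrite ltr0n.
have -> : - c + #|{: J * S}|%:R * (ln #|V|.+1%:R / #|V|%:R) =
    #|V|%:R^-1 * (- (#|V|%:R * c) + #|{: J * S}|%:R * ln #|V|.+1%:R).
  by field; rewrite gt_eqF.
rewrite ler_pM2l ?invr_gt0 // -ler_expR lnK ?posrE ?pair_Z_gt0 // expRD.
rewrite (mulr_natl (ln _)) -lnXn ?ltr0n // lnK ?posrE ?exprn_gt0 ?ltr0n //.
apply: le_trans (ler_wpM2l (expR_ge0 _) indep_empirical_sum_le).
rewrite mulr_sumr; apply: ler_sum => x _; rewrite gibbs_weight_empirical //.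
rewrite ler_pM2r ?indep_empirical_gt0 // ler_expR lerN2 ler_pM2l //.
exact/hc/empirical_prob.
Qed.
End Types.

End FiniteModel.

Lemma cvg_sum0 (R : realType) (I : finType) (f : nat -> I -> R) :
  (forall i, f n i @[n --> \oo] --> 0) -> \sum_i f n i @[n --> \oo] --> 0.
Proof.
move=> h; rewrite [X in _ --> X](_ : 0 = \sum_(i : I) 0); last by rewrite big1.
by apply: (@cvg_big R I +%R 0 xpredT (@add_continuous R) _ _ _
  (fun i n => f n i) (fun=> 0)) => i _; exact: h.
Qed.

(** * Limit of the normalised relative entropy as the number of nodes grows *)

Section ThermodynamicLimit.
Variables (R : realType) (J S : finType) (w : J -> J -> S -> S -> R).
Variables (g : forall N : nat, 'I_N -> J) (rho : J -> R).

Hypothesis rho_gt0 : forall j, 0 < rho j.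
Hypothesis density_cvg : forall j, density R (@g N) j @[N --> \oo] --> rho j.

Lemma rate_dist_cvg0 :
  rate_dist w (density R (@g N)) rho @[N --> \oo] --> 0.
Proof.
rewrite -[X in _ --> X]addr0; apply: cvgD.
  apply: cvg_sum0 => j; apply: cvg_sum0 => k.
  rewrite -[X in _ --> X](mul0r (w_norm w j k)).
  apply: cvgM; last exact: cvg_cst.
  apply/norm_cvg0P/subr_cvg0; exact: cvgM.
apply: cvg_sum0 => j; rewrite -[X in _ --> X](mul0r (#|S|%:R)).
apply: cvgM; last exact: cvg_cst.
by apply/norm_cvg0P/subr_cvg0.
Qed.

Lemma free_energy_cvg : exists C : R, forall q : family R J S, prob_family q ->
  N%:R^-1 * rel_entropy (indep (@g N) q) (pair_gibbs w (@g N))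
    @[N --> \oo] --> rate w rho q + C.
Proof.
(* The constant is the limit of [(1/N) * ln Z_N]. *)
exists (- inf [set rate w rho q | q in [set q | prob_family q]]) => q hq.
set I := inf _.
have S0 : (0 < #|S|)%N.
  by apply: prob_family_card hq; apply/card_gt0P; exists (g (ord0 : 'I_1)).
pose D N := rate_dist w (density R (@g N)) rho.
pose b N := 2 * w_total w / N%:R.
pose t N := #|{: J * S}|%:R * (ln N.+1%:R / N%:R) : R.
have bt0 N : 0 <= b N /\ 0 <= t N.
  split; last by rewrite mulr_ge0 ?divr_ge0 ?ln_ge0 ?ler1n.
  by rewrite divr_ge0 // mulr_ge0 // 2?sumr_ge0 // => ? _;
    do 3!apply: sumr_ge0 => ? _.
have t_cvg : t N @[N --> \oo] --> 0.
  rewrite -[X in _ --> X](mulr0 #|{: J * S}|%:R).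
  by apply: cvgM; [exact: cvg_cst | exact: ln_succ_div_cvg0].
have b_cvg : b N @[N --> \oo] --> 0.
  rewrite -[X in _ --> X](mulr0 (2 * w_total w)).
  by apply: cvgM; [exact: cvg_cst | rewrite -cvg_shiftS; exact: cvg_harmonic].
have e_cvg : 2 * (D N + b N + t N) @[N --> \oo] --> 0.
  rewrite -[X in _ --> X](mulr0 2); apply: cvgM; first exact: cvg_cst.
  rewrite -[X in _ --> X]addr0 -[X in _ --> X + _]addr0.
  by apply: cvgD => //; apply: cvgD => //; exact: rate_dist_cvg0.
(* Nonnegativity of the relative entropy, read as a lower bound on the limiting rate. It also shows
   that the rate is bounded below, as [ge_inf] requires. *)
have gibbs_lower N q' : (0 < N)%N -> prob_family q' ->
    - (N%:R^-1 * ln (pair_Z w (@g N))) - (D N + b N) <= rate w rho q'.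
  move=> N0 hq'; have V0 : (0 < #|'I_N|)%N by rewrite card_ord.
  have := rel_entropy_rate w (@g N) V0 S0 hq'.
  have := rate_distP w (density R (@g N)) rho hq'.
  have := rel_entropy_ge0 (indep_prob (@g N) hq') (pair_gibbs_prob w (@g N) S0)
    (fun x => pair_gibbs_gt0 w (@g N) x S0).
  rewrite -/(D N) card_ord -/(b N) => h.
  have {h} : 0 <= N%:R^-1 * rel_entropy (indep (@g N) q') (pair_gibbs w (@g N)).
    by rewrite mulr_ge0.
  rewrite !ler_norml => h /andP[h1 h2] /andP[h3 h4]; lra.
apply/subr_cvg0/norm_cvg0P.
apply: (squeeze_cvgr _ (cvg_cst 0) e_cvg).
(* Positive limits make every group eventually nonempty, so that the empirical families, which
   divide by group sizes, are probabilities. *)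
have dpos : \forall N \near \oo, forall j, 0 < density R (@g N) j.
  by apply: filter_forall => j; apply: cvgr_gt (rho_gt0 j).
near=> N; rewrite normr_ge0 /=.
have N0 : (0 < N)%N by near: N; exact: nbhs_infty_gt.
have V0 : (0 < #|'I_N|)%N by rewrite card_ord.
have count_pos j : (0 < count_group (@g N) j)%N.
  have : 0 < density R (@g N) j by move: j; near: N.
  by rewrite lt0n; apply: contraTneq => c0; rewrite /density c0 mul0r ltxx.
have I_lower : - (N%:R^-1 * ln (pair_Z w (@g N))) - (D N + b N) <= I.
  apply: lb_le_inf; first by exists (rate w rho q), q.
  by move=> _ [q' hq' <-]; apply: gibbs_lower.
have I_lb q' : prob_family q' -> I <= rate w rho q'.
  move=> hq'; apply: ge_inf; last by exists q'.
  by exists (- (N%:R^-1 * ln (pair_Z w (@g N))) - (D N + b N)) => _ [p hp <-];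
    exact: gibbs_lower.
(* The limiting rate is at least [I] and differs from the rate at size [N] by at most [D N], so
   [I - D N] bounds the latter from below. *)
have upper : N%:R^-1 * ln (pair_Z w (@g N)) <= - (I - D N) + t N.
  have := @ln_pair_Z_le _ _ _ w _ (@g N) count_pos (I - D N) V0 S0.
  rewrite card_ord; apply=> q' hq'.
  have := rate_distP w (density R (@g N)) rho hq'; rewrite -/(D N) ler_norml.
  by move=> /andP[h1 h2]; have := I_lb _ hq'; lra.
(* Replacing the relative entropy by the limiting rate costs [D N + b N]; replacing [(1/N) * ln Z_N]
   by [- I] costs at most [D N + b N + t N]. Hence the factor 2 in [e_cvg]. *)
have := rel_entropy_rate w (@g N) V0 S0 hq.
have := rate_distP w (density R (@g N)) rho hq.
have [b0 t0] := bt0 N.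
rewrite -/(D N) card_ord -/(b N) !ler_norml.
move=> /andP[h1 h2] /andP[h3 h4]; apply/andP; split; lra.
Unshelve. all: by end_near. Qed.

End ThermodynamicLimit.

(** * The block graph as an instance with [2 * r] groups *)

Section BlockGraph.
Variables (R : realType) (K r : nat) (W : 'I_K -> 'I_K -> R) (beta : R).

(* [(j, true)] stands for the central and [(j, false)] for the peripheral nodes
   of block [j]. *)
Definition group_of (N : nat) (G : block_graph r N) (i : 'I_N) : 'I_r * bool :=
  (block_of G i, i \in central_nodes G).

(** Two nodes interact when they share a block or are both peripheral. *)
Definition block_coupling (a b : 'I_r * bool) (s t : 'I_K) : R :=
  beta / 2 * ((a.1 == b.1) || (~~ a.2 && ~~ b.2))%:R * W s t.

Definition block_family (qc qp : 'I_r -> 'I_K -> R) :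
    family R ('I_r * bool)%type 'I_K :=
  fun a => if a.2 then qc a.1 else qp a.1.

Lemma big_pair_bool (T : Type) (idx : T) (op : Monoid.com_law idx)
    (I : finType) (F : I * bool -> T) :
  \big[op/idx]_a F a = \big[op/idx]_i op (F (i, true)) (F (i, false)).
Proof.
rewrite (eq_bigr (fun a => F (a.1, a.2))); last by case.
rewrite -(pair_bigA _ (fun i b => F (i, b))) /=.
by apply: eq_bigr => i _; rewrite big_bool.
Qed.

Lemma in_central N (G : block_graph r N) j i :
  (i \in central G j) = (group_of G i == (j, true)).
Proof. by rewrite !inE xpair_eqE eqb_id. Qed.

Lemma in_peripheral N (G : block_graph r N) j i :
  (i \in peripheral G j) = (group_of G i == (j, false)).
Proof. by rewrite !inE xpair_eqE eqbF_neg andbC. Qed.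

(** The central and peripheral sets partition the nodes. A generic operation covers both the sum in
    the energy and the product in the measure. *)
Lemma big_group_of (T : Type) (idx : T) (op : Monoid.com_law idx)
    (N : nat) (G : block_graph r N) (F : 'I_r * bool -> 'I_N -> T) :
  \big[op/idx]_(j < r) op (\big[op/idx]_(i in central G j) F (j, true) i)
    (\big[op/idx]_(i in peripheral G j) F (j, false) i) =
  \big[op/idx]_i F (group_of G i) i.
Proof.
rewrite [RHS](partition_big (group_of G) xpredT) //= big_pair_bool.
apply: eq_bigr => j _; congr (op _ _).
  by apply: eq_big => i; [exact: in_central | rewrite in_central => /eqP ->].
by apply: eq_big => i;
  [exact: in_peripheral | rewrite in_peripheral => /eqP ->].
Qed.

Lemma in_all_peripheral N (G : block_graph r N) k :
  (k \in all_peripheral G) = (k \notin central_nodes G).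
Proof.
apply/bigcupP/idP => [[j _]|h]; first by rewrite inE => /andP[].
by exists (block_of G k) => //; rewrite !inE h eqxx.
Qed.

Lemma energyE N (G : block_graph r N) x :
  energy W beta G x = pair_energy block_coupling (group_of G) x.
Proof.
rewrite /energy /pair_energy card_ord.
have -> : beta / (2 * N%:R) = N%:R^-1 * (beta / 2) by rewrite invfM; ring.
rewrite -mulrA; congr (_ * _).
pose E (a : 'I_r * bool) i := \sum_(k < N)
  ((a.1 == block_of G k) || (~~ a.2 && (k \notin central_nodes G)))%:R *
    W (x i) (x k).
rewrite (eq_bigr (fun j => \sum_(i in central G j) E (j, true) i +
    \sum_(i in peripheral G j) E (j, false) i)).
  rewrite (@big_group_of _ _ (@GRing.add R : Monoid.com_law 0) N G E).
  rewrite mulr_sumr; apply: eq_bigr => i _; rewrite mulr_sumr.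
  by apply: eq_bigr => k _; rewrite /block_coupling /= mulrA.
move=> j _; congr (_ + _); apply: eq_bigr => i _;
  rewrite big_mkcond; apply: eq_bigr => k _ /=.
  by rewrite inE orbF eq_sym; case: eqP; rewrite ?mul1r ?mul0r.
(* A node lies in [central G j :|: all_peripheral G] exactly when it is in block [j] or is
   peripheral. *)
rewrite !inE in_all_peripheral (eq_sym j).
by case: eqP; case: (k \in _); rewrite ?mul1r ?mul0r.
Qed.

Lemma FbarE N (G : block_graph r N) qc qp :
  Fbar W beta G qc qp = N%:R^-1 *
    rel_entropy (indep (group_of G) (block_family qc qp))
                (pair_gibbs block_coupling (group_of G)).
Proof.
congr (_ * rel_entropy _ _); apply/funext => x.
  exact: (@big_group_of _ _ (@GRing.mul R : Monoid.com_law 1) N G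
    (fun a i => block_family qc qp a (x i))).
rewrite /gibbs /pair_gibbs energyE; congr (_ / _).
by apply: eq_bigr => y _; rewrite energyE.
Qed.

Let B (p q : 'I_K -> R) := \sum_(z < K) (\sum_(z' < K) W z z' * q z') * p z.

Lemma rate_blockE (alpha pc pp : 'I_r -> R) C qc qp :
  (forall z z', W z z' = W z' z) ->
  rate block_coupling
    (fun a => alpha a.1 * if a.2 then pc a.1 else pp a.1)
    (block_family qc qp) + C = F W beta alpha pc pp C qc qp.
Proof.
move=> W_sym; congr (_ + _); rewrite /rate; congr (_ + _); last first.
  by rewrite big_pair_bool; apply: eq_bigr.
have meanE a b : mean_w block_coupling (block_family qc qp) a b =
    beta / 2 * ((a.1 == b.1) || (~~ a.2 && ~~ b.2))%:R *
      B (block_family qc qp a) (block_family qc qp b).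
  rewrite mulr_sumr; apply: eq_bigr => s _.
  rewrite mulr_suml mulr_sumr; apply: eq_bigr => t _.
  rewrite /block_coupling; ring.
(* Symmetry merges the central-peripheral and peripheral-central terms of a block, producing the
   coefficient 2 in [F]. *)
have B_sym p q : B p q = B q p.
  rewrite /B; under eq_bigr => z _ do rewrite mulr_suml.
  rewrite exchange_big; apply: eq_bigr => z _; rewrite mulr_suml.
  by apply: eq_bigr => z' _; rewrite W_sym; ring.
rewrite big_pair_bool; apply: eq_bigr => j _; rewrite !big_pair_bool /=.
under eq_bigr => k _ do rewrite !meanE /=.
under [X in _ + X = _]eq_bigr => k _ do rewrite !meanE /=.
have diag (f : 'I_r -> R) : \sum_k (j == k)%:R * f k = f j.
  rewrite (bigD1 j) //= eqxx mul1r big1 ?addr0 // => k.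
  by rewrite eq_sym => /negPf ->; rewrite mul0r.
have -> : \sum_(z < K) (\sum_(k < r) alpha k * pp k *
      \sum_(z' < K) W z z' * qp k z') * qp j z =
    \sum_k alpha k * pp k * B (qp j) (qp k).
  under eq_bigr => z _ do rewrite mulr_suml.
  rewrite exchange_big; apply: eq_bigr => k _; rewrite mulr_sumr.
  by apply: eq_bigr => z _; rewrite mulrA.
rewrite -/(B (qc j) (qc j)) -/(B (qc j) (qp j)).
rewrite (eq_bigr (fun k => (j == k)%:R * (alpha j * pc j * beta / 2 *
  (alpha k * pc k * B (qc j) (qc k) + alpha k * pp k * B (qc j) (qp k)))));
  last by move=> k _; rewrite !orbF; ring.
rewrite diag.
(* From a peripheral group, coupling to central nodes survives only for [k = j], while coupling to
   peripheral nodes runs over all blocks. *)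
rewrite (eq_bigr (fun k => (j == k)%:R * (alpha j * pp j * beta / 2 *
  (alpha k * pc k * B (qp j) (qc k))) + alpha j * pp j * beta / 2 *
  (alpha k * pp k * B (qp j) (qp k))));
  last by move=> k _; rewrite orbF orbT (_ : true%:R = 1 :> R) //; ring.
rewrite big_split /= diag -mulr_sumr (B_sym (qp j)); ring.
Qed.

End BlockGraph.

Unset Implicit Arguments.

Theorem proposition3p3 (R : realType) (K r : nat)
    (W : 'I_K -> 'I_K -> R) (beta : R)
    (alpha pc pp : 'I_r -> R)
    (G : forall N : nat, block_graph r N)
    (W_sym : forall z z' : 'I_K, W z z' = W z' z)
    (beta_gt0 : 0 < beta)
    (alpha01 : forall j : 'I_r, 0 < alpha j < 1)
    (pc01 : forall j : 'I_r, 0 < pc j < 1)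
    (pp01 : forall j : 'I_r, 0 < pp j < 1)
    (pc_pp : forall j : 'I_r, pc j + pp j = 1)
    (alpha_sum : \sum_(j < r) alpha j = 1)
    (cvg_block : forall j : 'I_r,
       (#|block (G N) j|%:R / N%:R : R) @[N --> \oo] --> alpha j)
    (cvg_central : forall j : 'I_r,
       (#|central (G N) j|%:R / #|block (G N) j|%:R : R) @[N --> \oo] --> pc j)
    (cvg_peripheral : forall j : 'I_r,
       (#|peripheral (G N) j|%:R / #|block (G N) j|%:R : R)
         @[N --> \oo] --> pp j) :
  exists C : R, forall qc qp : 'I_r -> 'I_K -> R,
    (forall j : 'I_r, is_prob (qc j)) ->
    (forall j : 'I_r, is_prob (qp j)) ->
    Fbar W beta (G N) qc qp @[N --> \oo] --> F W beta alpha pc pp C qc qp.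
Proof.
(* The limiting fraction of all nodes that belong to group [a]. *)
pose rho (a : 'I_r * bool) := alpha a.1 * if a.2 then pc a.1 else pp a.1.
have rho_gt0 a : 0 < rho a.
  have /andP[a0 _] := alpha01 a.1; have /andP[c0 _] := pc01 a.1.
  by have /andP[p0 _] := pp01 a.1; rewrite mulr_gt0 //; case: (a.2).
(* If [B] is empty, the division by 0 is harmless: [A] is empty too and both sides are 0. *)
have cardM N (A : {set 'I_N}) (B : {set 'I_N}) : (A \subset B)%SET ->
    #|A|%:R / N%:R = #|B|%:R / N%:R * (#|A|%:R / #|B|%:R) :> R.
  move=> /subset_leq_card; have [->|B0] := eqVneq #|B| 0%N.
    by rewrite leqn0 => /eqP ->; rewrite !mul0r.
  by move=> _; rewrite [RHS]mulrC mulrA divfK ?pnatr_eq0.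
have density_cvg a : density R (group_of (G N)) a @[N --> \oo] --> rho a.
  case: a => j [].
    rewrite (_ : (fun N => _) = fun N => #|block (G N) j|%:R / N%:R *
        (#|central (G N) j|%:R / #|block (G N) j|%:R)); first exact: cvgM.
    apply/funext => N; rewrite -cardM ?subsetIl // /density card_ord.
    by congr (_%:R / _); apply: eq_card => i; rewrite in_central inE.
  rewrite (_ : (fun N => _) = fun N => #|block (G N) j|%:R / N%:R *
      (#|peripheral (G N) j|%:R / #|block (G N) j|%:R)); first exact: cvgM.
  apply/funext => N; rewrite -cardM ?subsetDl // /density card_ord.
  by congr (_%:R / _); apply: eq_card => i; rewrite in_peripheral inE.
have [C hC] := free_energy_cvg (block_coupling W beta) rho_gt0 density_cvg.
exists C => qc qp hqc hqp.
rewrite -rate_blockE //; under eq_fun do rewrite FbarE.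
by apply: hC => -[j []]; [exact: hqc | exact: hqp].
Qed.
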